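(* Let $\mathcal{A}=\{\mathbf{a}^1,\ldots,\mathbf{a}^k\}\subset[0,1]^n$, let $\mathcal{V}_{\mathcal{Z}}$ and $\mathcal{S}_{\mathcal{Z}}$ be respectively Zadeh's max-$C$ PAFMM and Zadeh's min-$D$ PAFMM associated with $\mathcal{A}$, and let $\mathbf{x}\in[0,1]^n$. If there exists a unique $\gamma\in\{1,\ldots,k\}$ such that $\mathbf{a}^\gamma\leq\mathbf{x}$, then $\mathcal{V}_{\mathcal{Z}}(\mathbf{x})=\mathbf{a}^\gamma$. Furthermore, if there exists a unique $\mu\in\{1,\ldots,k\}$ such that $\mathbf{a}^\mu\geq\mathbf{x}$, then $\mathcal{S}_{\mathcal{Z}}(\mathbf{x})=\mathbf{a}^\mu$.
   Context: Gaines' connectives on $[0,1]$ are: the fuzzy implication $I_G(x,y)=1$ if $x\leq y$ and $0$ if $x>y$; the fuzzy conjunction $C_G(x,y)=0$ if $x=0$ and $y$ otherwise; the fuzzy disjunction $D_G(x,y)=1$ if $x=1$ and $y$ otherwise; the fuzzy co-implication $J_G(x,y)=0$ if $x\geq y$ and $1$ if $x<y$. Vectors in $[0,1]^n$ are ordered componentwise; $\bigvee$ and $\bigwedge$ of vectors are componentwise supremum and infimum. For $\lambda\in[0,1]$ and $\mathbf{a}\in[0,1]^n$, $C_G(\lambda,\mathbf{a})$ is the vector with components $C_G(\lambda,a_i)$; similarly for $D_G(\theta,\mathbf{a})$. Zadeh's max-$C$ projection autoassociative fuzzy morphological memory (PAFMM) $\mathcal{V}_{\mathcal{Z}}:[0,1]^n\to[0,1]^n$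 and Zadeh's min-$D$ PAFMM $\mathcal{S}_{\mathcal{Z}}:[0,1]^n\to[0,1]^n$ associated with $\mathcal{A}=\{\mathbf{a}^1,\ldots,\mathbf{a}^k\}$ are defined by $$\mathcal{V}_{\mathcal{Z}}(\mathbf{x})=\bigvee_{\xi=1}^k C_G(\lambda_\xi,\mathbf{a}^\xi),\quad \lambda_\xi=\bigwedge_{j=1}^n I_G(a_j^\xi,x_j),$$ $$\mathcal{S}_{\mathcal{Z}}(\mathbf{x})=\bigwedge_{\xi=1}^k D_G(\theta_\xi,\mathbf{a}^\xi),\quad \theta_\xi=\bigvee_{j=1}^n J_G(a_j^\xi,x_j).$$ *)

(* Defs.v *)
From mathcomp Require Import all_boot all_order all_algebra.
From mathcomp Require Import interval_inference reals.

Set Implicit Arguments.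
Unset Strict Implicit.
Unset Printing Implicit Defensive.

Import Order.TTheory GRing.Theory Num.Theory.
Local Open Scope ring_scope.

Section Gaines.
Variable R : realType.
Implicit Types x y : {i01 R}.

Definition gaines_impl x y : {i01 R} := if x <= y then 1%:i01 else 0%:i01.

Definition gaines_conj x y : {i01 R} := if x == 0%:i01 then 0%:i01 else y.

Definition gaines_disj x y : {i01 R} := if x == 1%:i01 then 1%:i01 else y.

Definition gaines_coimpl x y : {i01 R} := if x >= y then 0%:i01 else 1%:i01.

End Gaines.

Section ZadehPAFMM.
Variables (R : realType) (n k : nat).

Definition cube := {ffun 'I_n -> {i01 R}}.

Definition cube_le (u v : cube) : Prop := forall i, u i <= v i.

(* A finite supremum (resp. infimum) in the complete lattice [0,1] is the
   iterated maximum started at 0 (resp. minimum started at 1), so that the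
   supremum (resp. infimum) of the empty family is 0 (resp. 1). *)
Definition zadeh_lambda (a : 'I_k -> cube) (x : cube) (xi : 'I_k) : {i01 R} :=
  \big[Order.min/1%:i01]_(j < n) gaines_impl (a xi j) (x j).

Definition zadeh_maxC (a : 'I_k -> cube) (x : cube) : cube :=
  [ffun i => \big[Order.max/0%:i01]_(xi < k)
               gaines_conj (zadeh_lambda a x xi) (a xi i)].

Definition zadeh_theta (a : 'I_k -> cube) (x : cube) (xi : 'I_k) : {i01 R} :=
  \big[Order.max/0%:i01]_(j < n) gaines_coimpl (a xi j) (x j).

Definition zadeh_minD (a : 'I_k -> cube) (x : cube) : cube :=
  [ffun i => \big[Order.min/1%:i01]_(xi < k)
               gaines_disj (zadeh_theta a x xi) (a xi i)].

End ZadehPAFMM.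

(* Main.v *)
Require Import Defs.
From mathcomp Require Import all_boot all_order all_algebra.
From mathcomp Require Import interval_inference reals.

(* The inclusion degree lambda_xi is crisp: it is 1 if a^xi <= x and 0
   otherwise, and 0 annihilates the conjunction. So only the patterns below x
   contribute to the max-C memory; dually for the min-D memory. *)

Set Implicit Arguments.
Unset Strict Implicit.
Unset Printing Implicit Defensive.

Import Order.TTheory GRing.Theory Num.Theory.
Local Open Scope ring_scope.

Section UnitInterval.
Variable R : realType.
Implicit Types y : {i01 R}.

Lemma i01_ge0 y : 0%:i01 <= y.
Proof. by rewrite -num_le /=; exact: ge0. Qed.

Lemma i01_le1 y : y <= 1%:i01.
Proof. by rewrite -num_le /=; exact: le1. Qed.

Lemma i01_1_neq0 : (1%:i01 == 0%:i01 :> {i01 R}) = false.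
Proof. by rewrite -num_eq /= oner_eq0. Qed.

Lemma i01_0_neq1 : (0%:i01 == 1%:i01 :> {i01 R}) = false.
Proof. by rewrite eq_sym i01_1_neq0. Qed.

(** The starting value 0 is the bottom of the unit interval, so it cannot exceed a dominating term.
    This evaluates both the degrees and the memories. *)
Lemma bigmax_i01_eq (I : finType) (F : I -> {i01 R}) i :
  (forall j, F j <= F i) -> \big[Order.max/0%:i01]_j F j = F i.
Proof.
move=> Fi; apply/le_anti/andP; split; last exact: le_bigmax.
by apply/bigmax_leP; split=> [|j _]; [exact: i01_ge0|exact: Fi].
Qed.

Lemma bigmin_i01_eq (I : finType) (F : I -> {i01 R}) i :
  (forall j, F i <= F j) -> \big[Order.min/1%:i01]_j F j = F i.
Proof.
move=> Fi; apply/le_anti/andP; split; first exact: bigmin_le.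
by apply/bigmin_geP; split=> [|j _]; [exact: i01_le1|exact: Fi].
Qed.

End UnitInterval.

Section CrispDegrees.
Variables (R : realType) (n k : nat) (a : 'I_k -> cube R n) (x : cube R n).

(** The index set is finite, so the order is decidable and the degrees can be given by a case split
    on it. *)
Lemma cube_leP (u v : cube R n) :
  reflect (cube_le u v) [forall i, u i <= v i].
Proof. exact: forallP. Qed.

Lemma zadeh_lambdaE xi :
  zadeh_lambda a x xi =
  if [forall j, a xi j <= x j] then 1%:i01 else 0%:i01.
Proof.
rewrite /zadeh_lambda /gaines_impl; case: ifPn => [/forallP ax|].
  (* Being equal to 1 holds for the starting value, which settles [n = 0], and for each term, and is
     stable under minimum. *)
  by apply: (big_ind (eq^~ 1%:i01)) => // [_ _ -> ->|j _];
    rewrite ?minxx ?ax.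
rewrite negb_forall => /existsP[j /negbTE axj].
(* The violated component [j] yields the bottom value 0, so the minimum is attained there. *)
by rewrite (@bigmin_i01_eq _ _ _ j) axj // => i; exact: i01_ge0.
Qed.

(** Dually, a single failing comparison yields the top value 1, which absorbs the maximum. *)
Lemma zadeh_thetaE xi :
  zadeh_theta a x xi =
  if [forall j, x j <= a xi j] then 0%:i01 else 1%:i01.
Proof.
rewrite /zadeh_theta /gaines_coimpl; case: ifPn => [/forallP xa|].
  by apply: (big_ind (eq^~ 0%:i01)) => // [_ _ -> ->|j _];
    rewrite ?maxxx ?xa.
rewrite negb_forall => /existsP[j /negbTE xaj].
by rewrite (@bigmax_i01_eq _ _ _ j) xaj // => i; exact: i01_le1.
Qed.

(** The value 0 left by a rejected pattern is neutral for the outer maximum. *)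
Lemma zadeh_conj_lambda xi y :
  gaines_conj (zadeh_lambda a x xi) y =
  if [forall j, a xi j <= x j] then y else 0%:i01.
Proof.
rewrite zadeh_lambdaE /gaines_conj.
by case: [forall j, _ <= _]; rewrite ?i01_1_neq0 ?eqxx.
Qed.

Lemma zadeh_disj_theta xi y :
  gaines_disj (zadeh_theta a x xi) y =
  if [forall j, x j <= a xi j] then y else 1%:i01.
Proof.
rewrite zadeh_thetaE /gaines_disj.
by case: [forall j, _ <= _]; rewrite ?i01_0_neq1 ?eqxx.
Qed.

End CrispDegrees.

Theorem theorem5 (R : realType) (n k : nat)
    (a : 'I_k -> cube R n) (x : cube R n) :
  (forall gamma : 'I_k,
     unique (fun xi : 'I_k => cube_le (a xi) x) gamma ->
     zadeh_maxC a x = a gamma) /\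
  (forall mu : 'I_k,
     unique (fun xi : 'I_k => cube_le x (a xi)) mu ->
     zadeh_minD a x = a mu).
Proof.
split=> [gamma [/cube_leP le_x uniq_x]|mu [/cube_leP ge_x uniq_x]];
  apply/ffunP => i; rewrite ffunE.
- under eq_bigr => xi _ do rewrite zadeh_conj_lambda.
  (* The term at [gamma] is [a gamma i], and it dominates: by uniqueness any accepted [xi] is
     [gamma] itself, and the others give 0. *)
  rewrite (@bigmax_i01_eq _ _ _ gamma) le_x // => xi.
  by case: ifP => [/cube_leP/uniq_x <-|_]; last exact: i01_ge0.
- under eq_bigr => xi _ do rewrite zadeh_disj_theta.
  (* Here the rejected patterns give 1, so the term at [mu] is the least one. *)
  rewrite (@bigmin_i01_eq _ _ _ mu) ge_x // => xi.
  by case: ifP => [/cube_leP/uniq_x <-|_]; last exact: i01_le1.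
Qed.
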